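(* For a linear network of size $n$ with all the line reactances equal to $a$, an upper bound of $\mathrm{PoSA}_{\max}$ is given by $$\mathrm{PoSA}_{\max}(X,Y)\le\frac{(an)^2}{\Big(\frac{a}{2+2\cos\frac{2\pi}{2n+1}}+an+y\Big)^2\Big(y+\frac{a}{2+2\cos\frac{2\pi}{2n+1}}\Big)} .$$
   Context: Linear network of size $n$: the path $0-1-2-\cdots-n$ rooted at $0$ with lines $(i,i+1)$, $i=0,\dots,n-1$, of reactances $x_{i,i+1}>0$. The reactance matrix $X\in\mathbb R^{n\times n}$ is $X_{ij}=\sum_{k=0}^{\min(i,j)-1}x_{k,k+1}$ (so when all line reactances equal $a>0$, $X_{ij}=a\min(i,j)$). $D=\mathrm{diag}(X_{11},\dots,X_{nn})$; $Y=\mathrm{diag}(y_1,\dots,y_n)$ with all $y_i>0$; $y=\min_i y_i$. For $\Delta\tilde v\in\mathbb R^n$ let $F(q)=\frac12q^\top(X+Y)q+q^\top\Delta\tilde v$ and $W(q)=\frac12q^\top(X+D+Y)q+q^\top\Delta\tilde v$ on $\mathbb R^n$, with unique minimizers $q^*=-(X+Y)^{-1}\Delta\tilde v$ and $q^a=-(X+D+Y)^{-1}\Delta\tilde v$ respectively. $\mathrm{PoSA}=F(q^a)-F(q^* )$ and $\mathrm{PoSA}_{\max}(X,Y)=\sup_{\Delta\tilde v\neq0}\frac{\mathrm{PoSA}}{\Delta\tilde v^\top\Delta\tilde v}$, which equals $\frac12\lambda_{\max}(\Pi)$ with $\Pi=(X+D+Y)^{-1}D(X+Y)^{-1}D(X+D+Y)^{-1}$.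 *)

(* Defs.v *)
From HB Require Import structures.
From mathcomp Require Import all_boot all_order all_algebra.
From mathcomp Require Import all_classical all_reals all_analysis.
From mathcomp Require Import ring lra.

Set Implicit Arguments.
Unset Strict Implicit.
Unset Printing Implicit Defensive.

Import Order.TTheory GRing.Theory Num.Theory.
Local Open Scope classical_set_scope.
Local Open Scope ring_scope.

Section Definitions.
Variables (R : realType) (n : nat).
Implicit Types (X M Y : 'M[R]_n) (b q v : 'cV[R]_n) (x y : 'I_n -> R).

(* The path 0 - 1 - ... - n rooted at 0: [k : 'I_n] stands for the line
   (k, k+1) with reactance [x k], and the index [i : 'I_n] of a matrix stands
   for the node i+1.  Hence the summation range 0, ..., min(i+1, j+1) - 1 of
   the lines shared by the paths to the nodes i+1 and j+1 is
   [k <= minn i j]. *)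
Definition reactance_mx x : 'M[R]_n :=
  \matrix_(i, j) \sum_(k < n | (k <= minn i j)%N) x k.

Definition diag_part X : 'M[R]_n := diag_mx (\row_i X i i).

Definition fun_diag_mx y : 'M[R]_n := diag_mx (\row_i y i).

Definition quad_cost M b q : R :=
  2^-1 * (q^T *m M *m q) 0 0 + (q^T *m b) 0 0.

Definition is_minimizer (f : 'cV[R]_n -> R) q : Prop := forall p, f q <= f p.

(* A minimizer of [f] (0 if there is none); for the cost functions
   used here it exists, is unique, and is given by [opt_ctrlE] and
   [dec_ctrlE] below. *)
Definition argmin (f : 'cV[R]_n -> R) : 'cV[R]_n :=
  xget 0 [set q | is_minimizer f q].

Definition social_cost X Y v : 'cV[R]_n -> R := quad_cost (X + Y) v.

Definition game_potential X Y v : 'cV[R]_n -> R :=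
  quad_cost (X + diag_part X + Y) v.

Definition opt_ctrl X Y v : 'cV[R]_n := argmin (social_cost X Y v).

Definition dec_ctrl X Y v : 'cV[R]_n := argmin (game_potential X Y v).

Definition PoSA X Y v : R :=
  social_cost X Y v (dec_ctrl X Y v) - social_cost X Y v (opt_ctrl X Y v).

(* The supremum is taken in the extended reals, so that bounding it from above
   by a real number also asserts that the set of ratios is bounded. *)
Definition PoSA_max X Y : \bar R :=
  ereal_sup [set (PoSA X Y v / (v^T *m v) 0 0)%:E | v in [set v | v != 0]].

Definition min_entry (n_gt0 : (0 < n)%N) y : R :=
  \big[Num.min/y (Ordinal n_gt0)]_(i < n) y i.

End Definitions.

Section Facts.
Variable R : realType.

Definition posdef n (A : 'M[R]_n) : Prop :=
  A^T = A /\ forall q : 'cV[R]_n, q != 0 -> 0 < (q^T *m A *m q) 0 0.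

Lemma posdef_unitmx n (A : 'M[R]_n) : posdef A -> A \in unitmx.
Proof.
move=> [symA posA]; rewrite -row_free_unit -kermx_eq0.
apply/eqP/row_matrixP => i; rewrite row0; set u := row i _.
have uA : u *m A = 0 by rewrite /u -row_mul mulmx_ker row0.
apply/eqP/negPn/negP => u0.
have := posA u^T; rewrite -trmx0 (inj_eq trmx_inj) => /(_ u0).
by rewrite trmxK uA mul0mx mxE ltxx.
Qed.

Lemma quad_costB n (A : 'M[R]_n) (b q : 'cV[R]_n) : posdef A ->
  let q0 := - invmx A *m b in
  quad_cost A b q - quad_cost A b q0 =
  2^-1 * ((q - q0)^T *m A *m (q - q0)) 0 0.
Proof.
move=> pA q0; have uA := posdef_unitmx pA; case: pA => symA _.
have -> : b = - (A *m q0).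
  by rewrite /q0 mulNmx mulmxN opprK mulKVmx.
clearbody q0.
rewrite /quad_cost.
have sw : (q0^T *m A *m q) 0 0 = (q^T *m A *m q0) 0 0.
  have <- : (q0^T *m A *m q)^T 0 0 = (q0^T *m A *m q) 0 0 by rewrite mxE.
  by rewrite !trmx_mul trmxK symA mulmxA.
rewrite !mulmxN !mulmxA [(q - q0)^T]linearB /= !(mulmxBl, mulmxBr).
have E (M N : 'M[R]_1) : (M - N) 0 0 = M 0 0 - N 0 0 by rewrite !mxE.
have E' (M : 'M[R]_1) : (- M) 0 0 = - M 0 0 by rewrite !mxE.
rewrite !E !E' sw; lra.
Qed.

Lemma is_minimizerP n (A : 'M[R]_n) (b q : 'cV[R]_n) : posdef A ->
  is_minimizer (quad_cost A b) q <-> q = - invmx A *m b.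
Proof.
move=> pA; have [_ posA] := pA; split.
  move=> /(_ (- invmx A *m b)); rewrite -subr_le0 quad_costB //.
  move=> h; apply/eqP; rewrite -subr_eq0; apply/negPn/negP => /posA h2.
  by move: h h2; set t := (_ *m _) 0 0; lra.
move=> -> p; rewrite -subr_ge0 quad_costB //.
set u := p - _; have [->|/posA h] := eqVneq u 0.
  by rewrite mulmx0 mxE mulr0.
by rewrite mulr_ge0 ?invr_ge0 // ltW.
Qed.

Lemma argminE n (A : 'M[R]_n) (b : 'cV[R]_n) : posdef A ->
  argmin (quad_cost A b) = - invmx A *m b.
Proof.
move=> pA; apply/(is_minimizerP b _ pA); rewrite /argmin.
apply: (@xgetPex _ 0 [set q | is_minimizer (quad_cost A b) q]).
by exists (- invmx A *m b); apply/(is_minimizerP b _ pA).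
Qed.

Lemma trmx_reactance n (x : 'I_n -> R) : (reactance_mx x)^T = reactance_mx x.
Proof. by apply/matrixP => i j; rewrite !mxE minnC. Qed.

Lemma reactance_quadE n (x : 'I_n -> R) (q : 'cV[R]_n) :
  (q^T *m reactance_mx x *m q) 0 0 =
  \sum_k x k * (\sum_(i < n | (k <= i)%N) q i 0) ^+ 2.
Proof.
rewrite mxE.
under eq_bigr => j _ do rewrite mxE mulr_suml.
under [RHS]eq_bigr => k _ do rewrite expr2 mulr_suml mulr_sumr.
under eq_bigr => j _ do under eq_bigr => i _ do
  rewrite !mxE mulr_sumr mulr_suml big_mkcond /=.
apply: (@etrans _ _ (\sum_(k < n) \sum_(j < n) \sum_(i < n)
   if (k <= minn i j)%N then q i 0 * x k * q j 0 else 0)).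
  rewrite [RHS]exchange_big /=; apply: eq_bigr => j _.
  by rewrite exchange_big.
apply: eq_bigr => k _; rewrite [RHS]big_mkcond; apply: eq_bigr => j _.
case: ifP => kj.
  rewrite mulr_sumr mulr_sumr [RHS]big_mkcond; apply: eq_bigr => i _.
  by rewrite leq_min kj andbT; case: ifP => // _; ring.
by rewrite big1 // => i _; rewrite leq_min kj andbF.
Qed.

Lemma diag_quadE n (d : 'rV[R]_n) (q : 'cV[R]_n) :
  (q^T *m diag_mx d *m q) 0 0 = \sum_i d 0 i * q i 0 ^+ 2.
Proof.
rewrite mul_mx_diag mxE; apply: eq_bigr => i _; rewrite !mxE; ring.
Qed.

Section Network.
Variables (n : nat) (x y : 'I_n -> R).
Hypotheses (x_gt0 : forall k, 0 < x k) (y_gt0 : forall i, 0 < y i).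
Let X := reactance_mx x.
Let Y := fun_diag_mx y.

Lemma reactance_quad_ge0 (q : 'cV[R]_n) : 0 <= (q^T *m X *m q) 0 0.
Proof.
by rewrite reactance_quadE sumr_ge0 // => k _; rewrite mulr_ge0 ?sqr_ge0 ?ltW.
Qed.

Lemma diag_part_quad_ge0 (q : 'cV[R]_n) : 0 <= (q^T *m diag_part X *m q) 0 0.
Proof.
rewrite diag_quadE sumr_ge0 // => i _; rewrite mulr_ge0 ?sqr_ge0 // !mxE.
by rewrite sumr_ge0 // => k _; exact: ltW.
Qed.

Lemma fun_diag_quad_gt0 (q : 'cV[R]_n) : q != 0 -> 0 < (q^T *m Y *m q) 0 0.
Proof.
move=> /cV0Pn[i qi0]; rewrite diag_quadE (bigD1 i) //= ltr_wpDr //.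
  by rewrite sumr_ge0 // => j _; rewrite mxE mulr_ge0 ?sqr_ge0 ?ltW.
by rewrite mxE mulr_gt0 // exprn_even_gt0.
Qed.

Lemma posdef_social : posdef (X + Y).
Proof.
split; first by rewrite linearD /= trmx_reactance tr_diag_mx.
move=> q q0; rewrite mulmxDr mulmxDl mxE.
by rewrite ltr_wpDl ?reactance_quad_ge0 ?fun_diag_quad_gt0.
Qed.

Lemma posdef_potential : posdef (X + diag_part X + Y).
Proof.
split; first by rewrite !linearD /= trmx_reactance !tr_diag_mx.
move=> q q0; rewrite !mulmxDr !mulmxDl mxE [X in 0 < X + _]mxE.
by rewrite ltr_wpDl ?addr_ge0 ?reactance_quad_ge0 ?diag_part_quad_ge0
  ?fun_diag_quad_gt0.
Qed.

Lemma opt_ctrlE (v : 'cV[R]_n) : opt_ctrl X Y v = - invmx (X + Y) *m v.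
Proof. exact/argminE/posdef_social. Qed.

Lemma dec_ctrlE (v : 'cV[R]_n) :
  dec_ctrl X Y v = - invmx (X + diag_part X + Y) *m v.
Proof. exact/argminE/posdef_potential. Qed.

End Network.

Lemma min_entryP n (n_gt0 : (0 < n)%N) (y : 'I_n -> R) :
  (exists i, min_entry n_gt0 y = y i) /\ (forall i, min_entry n_gt0 y <= y i).
Proof.
rewrite /min_entry; split; last by move=> i; exact: bigmin_le_cond.
apply: (big_ind (fun z => exists i, z = y i)); first by exists (Ordinal n_gt0).
- by move=> _ _ [i ->] [j ->]; case: (leP (y i) (y j)) => _;
    [exists i|exists j].
- by move=> i _; exists i.
Qed.

End Facts.

(* Main.v *)
Require Import Defs.
From HB Require Import structures.
From mathcomp Require Import all_boot all_order all_algebra.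
From mathcomp Require Import all_classical all_reals all_analysis.
From mathcomp Require Import ring lra.

Import Order.TTheory GRing.Theory Num.Theory.
Local Open Scope classical_set_scope.
Local Open Scope ring_scope.

(** Write N = X + Y, D for the diagonal part of X, and let m > 0 satisfy N >= m I.
    The optimal control qo and the decentralized control qa satisfy the
    first-order conditions N qo = - v and (N + D) qa = - v; hence
    N (qa - qo) = - D qa and
    PoSA = 1/2 <qa - qo, N (qa - qo)> <= |D qa|^2 / (2 m)
    by coercivity ([coercive_quad_le_sqnorm]). It remains to compare |D qa| with
    |v| = |(N + D) qa|. For positive definite matrices that do not commute, the
    norm of D (N + D)^-1 may exceed 1. Here, however, the cross term
    <D w, N w> is nonnegative: this is obvious for Y, and for X it follows from
    the path structure ([diag_part_reactance_ge0]). With L an upper bound of the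
    entries of D, this gives
    |(N + D) w|^2 >= |D w|^2 + |N w|^2 >= (1 + (m/L)^2) |D w|^2
                  >= 1/2 (1 + m/L)^2 |D w|^2,
    and the last factor 1/2 cancels the one in front of the PoSA
    ([PoSA_le_coercive]).

    For equal reactances a, L = a n, and m = ymin + c works because X >= c I
    ([uniform_reactance_coercive]). In terms of the tail sums s of q, the latter
    says that the sum of the squared increments of s is at most
    2 + 2 cos t, t = 2 pi / (2 n + 1), times the sum of its squares. This is
    proved by weighting the products of neighbours with the positive
    eigenvector sin (j t)
    ([sum_sqr_increments_le]). *)

(** * Coercive matrices and diagonal perturbations *)

Section DotProduct.
Context {R : realType} {n : nat}.
Implicit Types (u v w : 'cV[R]_n) (N : 'M[R]_n).

Definition dot u v : R := (u^T *m v) 0 0.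

Lemma dotE u v : dot u v = \sum_i u i 0 * v i 0.
Proof. by rewrite /dot mxE; apply: eq_bigr => i _; rewrite mxE. Qed.

Lemma dotC u v : dot u v = dot v u.
Proof. by rewrite !dotE; apply: eq_bigr => i _; rewrite mulrC. Qed.

Lemma dotDr u v w : dot u (v + w) = dot u v + dot u w.
Proof. by rewrite /dot mulmxDr mxE. Qed.

Lemma dotDl u v w : dot (u + v) w = dot u w + dot v w.
Proof. by rewrite dotC dotDr !(dotC w). Qed.

Lemma dotZr k u v : dot u (k *: v) = k * dot u v.
Proof. by rewrite /dot -scalemxAr mxE. Qed.

Lemma dotZl k u v : dot (k *: u) v = k * dot u v.
Proof. by rewrite dotC dotZr dotC. Qed.

Lemma dotNN u v : dot (- u) (- v) = dot u v.
Proof. by rewrite -(scaleN1r u) -(scaleN1r v) dotZl dotZr mulrA mulN1r opprK mul1r. Qed.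

Lemma dot_quad N u v : (u^T *m N *m v) 0 0 = dot u (N *m v).
Proof. by rewrite /dot mulmxA. Qed.

Lemma dot_ge0 u : 0 <= dot u u.
Proof. by rewrite dotE sumr_ge0 // => i _; rewrite -expr2 sqr_ge0. Qed.

Lemma dot_gt0 u : u != 0 -> 0 < dot u u.
Proof.
move=> /cV0Pn[i ui0]; rewrite dotE (bigD1 i) //= ltr_wpDr //.
  by rewrite sumr_ge0 // => j _; rewrite -expr2 sqr_ge0.
by rewrite -expr2 exprn_even_gt0.
Qed.

(** Expand 0 <= |N u - m u|^2; for symmetric N this is the bound m N <= N^2. *)
Lemma coercive_quad_le_sqnorm N (m : R) u :
    0 < m -> (forall q, m * dot q q <= dot q (N *m q)) ->
  m * dot u (N *m u) <= dot (N *m u) (N *m u).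
Proof.
move=> m0 /(_ u) mN.
have := dot_ge0 (N *m u + (- m) *: u).
rewrite !(dotDl, dotDr, dotZl, dotZr) (dotC (N *m u) u).
move: mN; set s := dot u u; set t := dot u _; set p := dot _ _ => mN.
have := ler_wpM2l (ltW m0) mN; nra.
Qed.

Lemma diag_dotE (d : 'rV[R]_n) u v :
  dot u (diag_mx d *m v) = \sum_i d 0 i * (u i 0 * v i 0).
Proof.
by rewrite dotE; apply: eq_bigr => i _; rewrite mul_diag_mx mxE; ring.
Qed.

Lemma diag_sqnorm_le (d : 'rV[R]_n) (L : R) u :
    (forall i, 0 <= d 0 i <= L) ->
  dot (diag_mx d *m u) (diag_mx d *m u) <= L ^+ 2 * dot u u.
Proof.
move=> dL; rewrite !dotE mulr_sumr; apply: ler_sum => i _.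
rewrite mul_diag_mx mxE; have /andP[d0 dl] := dL i.
have -> : d 0 i * u i 0 * (d 0 i * u i 0) = d 0 i ^+ 2 * (u i 0 * u i 0) by ring.
by rewrite ler_wpM2r -?expr2 ?sqr_ge0 // lerXn2r ?nnegrE // (le_trans d0).
Qed.

(** The nonnegative cross term leaves |(N + D) w|^2 >= |D w|^2 + |N w|^2, and
    m |D w| <= L m |w| <= L |N w|. The factor 2 is the price of
    (L + m)^2 <= 2 (L^2 + m^2). *)
Lemma perturbed_sqnorm_ge N (d : 'rV[R]_n) (m L : R) w :
    0 < m -> (forall q, m * dot q q <= dot q (N *m q)) ->
    (forall i, 0 <= d 0 i <= L) ->
    0 <= dot (diag_mx d *m w) (N *m w) ->
  (L + m) ^+ 2 * dot (diag_mx d *m w) (diag_mx d *m w) <=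
  2 * L ^+ 2 * dot ((N + diag_mx d) *m w) ((N + diag_mx d) *m w).
Proof.
move=> m0 mN dL DN.
have mw := coercive_quad_le_sqnorm N m w m0 mN.
have Dw := diag_sqnorm_le d L w dL.
have := mN w; have s0 := dot_ge0 (diag_mx d *m w).
rewrite mulmxDl !(dotDl, dotDr) (dotC (N *m w) (_ *m w)).
move: mw Dw DN s0.
set p := dot (N *m w) _; set s := dot (diag_mx d *m w) (diag_mx d *m w).
set e := dot (diag_mx d *m w) _.
set t := dot w (N *m w); set z := dot w w => mw Dw DN s0 mN'.
have h1 : m ^+ 2 * z <= p by nra.
have h2 : m ^+ 2 * s <= L ^+ 2 * p.
  apply: le_trans (_ : m ^+ 2 * (L ^+ 2 * z) <= _).
    by rewrite ler_wpM2l ?sqr_ge0.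
  by rewrite mulrCA ler_wpM2l ?sqr_ge0.
have h3 : 0 <= L ^+ 2 * e by rewrite mulr_ge0 ?sqr_ge0.
(* 2 (L^2 + m^2) - (L + m)^2 = (L - m)^2 *)
have h4 : 0 <= (L - m) ^+ 2 * s by rewrite mulr_ge0 ?sqr_ge0.
by move: h2 h3 h4; rewrite !expr2; nra.
Qed.

End DotProduct.

(** * The reactance matrix and its diagonal part *)

Section Network.
Context {R : realType} {n : nat}.
Variable x : 'I_n -> R.
Let X := reactance_mx x.

Lemma reactance_mx_diag_or i j : (X i j == X i i) || (X i j == X j j).
Proof.
by case: (leqP i j) => ij; rewrite !mxE !minnn;
  [rewrite (minn_idPl ij) | rewrite (minn_idPr (ltnW ij))]; rewrite eqxx ?orbT.
Qed.

Hypothesis x_gt0 : forall k, 0 < x k.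

(** The entrywise square of X is positive semidefinite, as in the Schur product
    theorem: expanding one of the two factors X i j as a sum over the lines k
    shared by i and j turns the form into a nonnegative combination of the
    values of X at the truncations of w to the nodes behind k. *)
Lemma reactance_schur_ge0 (w : 'cV[R]_n) :
  0 <= \sum_i \sum_j w i 0 * w j 0 * X i j ^+ 2.
Proof.
pose wk (k : 'I_n) : 'cV[R]_n := \col_i (if (k <= i)%N then w i 0 else 0).
suff -> : \sum_i \sum_j w i 0 * w j 0 * X i j ^+ 2 =
    \sum_k x k * ((wk k)^T *m X *m wk k) 0 0.
  by rewrite sumr_ge0 // => k _; rewrite mulr_ge0 ?reactance_quad_ge0 ?ltW.
under [RHS]eq_bigr => k _ do rewrite dot_quad dotE mulr_sumr.
rewrite [RHS]exchange_big; apply: eq_bigr => i _ /=.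
under [RHS]eq_bigr => k _ do rewrite [(X *m _) _ _]mxE mulr_sumr mulr_sumr.
rewrite [RHS]exchange_big; apply: eq_bigr => j _ /=.
rewrite expr2 mulrA {2}/X [in LHS]mxE mulr_sumr big_mkcond.
apply: eq_bigr => k _; rewrite !mxE leq_min.
by do 2!case: leqP => _ /=; ring.
Qed.

(** X i j is one of X i i and X j j, so (X i i - X i j) (X j j - X i j) = 0, that is
    (X i i + X j j) X i j = X i j ^+ 2 + X i i * X j j.
    Thus D X + X D is the sum of the entrywise square of X and of a rank-one
    square. *)
Lemma diag_part_reactance_ge0 (w : 'cV[R]_n) :
  0 <= dot (diag_part X *m w) (X *m w).
Proof.
have E : dot (diag_part X *m w) (X *m w) =
    \sum_i \sum_j w i 0 * w j 0 * (X i i * X i j).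
  rewrite dotE; apply: eq_bigr => i _; rewrite mul_diag_mx !mxE mulr_sumr.
  by apply: eq_bigr => j _; rewrite !mxE; ring.
have E' : dot (diag_part X *m w) (X *m w) =
    \sum_i \sum_j w i 0 * w j 0 * (X j j * X i j).
  rewrite E exchange_big; apply: eq_bigr => i _; apply: eq_bigr => j _.
  have -> : X j i = X i j by rewrite -[in LHS](trmx_reactance x : X^T = X) mxE.
  by ring.
(* Adding E and E' replaces the kernel by that of D X + X D. *)
suff : 0 <= dot (diag_part X *m w) (X *m w) *+ 2 by rewrite pmulrn_lge0.
rewrite mulr2n {1}E E' -big_split /=.
under eq_bigr => i _ do rewrite -big_split /=.
have -> : \sum_i \sum_j (w i 0 * w j 0 * (X i i * X i j) +
              w i 0 * w j 0 * (X j j * X i j)) =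
    \sum_i \sum_j w i 0 * w j 0 * X i j ^+ 2 + (\sum_i X i i * w i 0) ^+ 2.
  rewrite [X in _ + X]expr2 mulr_suml -big_split; apply: eq_bigr => i _ /=.
  rewrite mulr_sumr -big_split; apply: eq_bigr => j _ /=.
  by case/orP: (reactance_mx_diag_or i j) => /eqP ->; ring.
by rewrite addr_ge0 ?sqr_ge0 ?reactance_schur_ge0.
Qed.

End Network.

(** * A spectral lower bound for the uniform reactance matrix *)

Section TailSums.
Context {R : realType}.

(** After the sign change s_j -> (-1)^j s_j, the increments become sums and r is
    an eigenvector, positive on 1, ..., n, of the resulting quadratic form: the
    recurrence and the two boundary conditions r_0 = 0, r_{n+1} = - r_n say this.
    Each product s_j s_{j+1} is bounded by the weighted
    arithmetic-geometric mean inequality with weight r_{j+1} / r_j; the terms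
    then telescope. *)
Lemma sum_sqr_increments_le (C : R) (r s : nat -> R) (n : nat) :
    r 0%N = 0 -> (forall j, r j.+2 = 2 * C * r j.+1 - r j) ->
    (forall j, (0 < j <= n)%N -> 0 < r j) -> r n.+1 = - r n -> s 0%N = 0 ->
  \sum_(j < n) (s j.+1 - s j) ^+ 2 <= (2 + 2 * C) * \sum_(j < n) s j.+1 ^+ 2.
Proof.
move=> r0 rS rpos rn s0.
case: n => [|n] in rpos rn *; first by rewrite !big_ord0 mulr0.
(* A partial sum has the extra boundary term of the telescoping, which the
   hypothesis on r n.+1 makes vanish for the whole sum. *)
suff H m : (m <= n)%N -> \sum_(j < m.+1) (s j.+1 - s j) ^+ 2 <=
    (2 + 2 * C) * \sum_(j < m.+1) s j.+1 ^+ 2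
    - (1 + r m.+2 / r m.+1) * s m.+1 ^+ 2.
  apply: le_trans (H n (leqnn n)) _.
  have rn0 : r n.+1 != 0 by rewrite gt_eqF // rpos //= leqnn.
  by rewrite rn mulNr divff // subrr mul0r subr0.
elim: m => [_|m IHm mn].
  rewrite !big_ord1 s0 subr0 rS r0 subr0 mulfK; last by rewrite gt_eqF // rpos.
  by rewrite le_eqVlt; apply/orP; left; apply/eqP; ring.
have p1 : 0 < r m.+1 by rewrite rpos //= ltnS ltnW.
have p2 : 0 < r m.+2 by rewrite rpos.
rewrite [X in X <= _]big_ord_recr [in X in _ <= X]big_ord_recr /=.
have {}IHm := IHm (ltnW mn).
apply: le_trans (lerD IHm (lexx _)) _.
rewrite -subr_ge0 (rS m.+1).
have -> : forall A B U V W : R, B != 0 -> W != 0 ->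
  (2 + 2 * C) * (A + U ^+ 2) - (1 + (2 * C * B - W) / B) * U ^+ 2 -
   ((2 + 2 * C) * A - (1 + B / W) * V ^+ 2 + (U - V) ^+ 2) =
  (W * U + B * V) ^+ 2 / (B * W).
  by move=> A B U V W B0 W0; field; rewrite B0 W0.
by rewrite divr_ge0 ?sqr_ge0 ?mulr_ge0 ?ltW.
all: by rewrite gt_eqF.
Qed.

Lemma sin_add2 (t : R) (j : nat) :
  sin (j.+2%:R * t) = 2 * cos t * sin (j.+1%:R * t) - sin (j%:R * t).
Proof.
have -> : j.+2%:R * t = j.+1%:R * t + t by rewrite -[j.+2]addn1 natrD; ring.
have -> : j%:R * t = j.+1%:R * t - t by rewrite -[j.+1]addn1 natrD; ring.
by rewrite sinD sinB; ring.
Qed.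

(** This reflection is the reason for the angle 2 pi / (2 n + 1): it yields the
    boundary condition sin ((n + 1) t) = - sin (n t). *)
Lemma succ_angleE n : let t : R := 2 * pi / (2 * n + 1)%:R in
  n.+1%:R * t = 2 * pi - n%:R * t.
Proof.
move=> t; apply/eqP; rewrite eq_sym subr_eq -mulrDl -natrD.
have -> : (n.+1 + n = 2 * n + 1)%N by rewrite mul2n -addnn addn1 addSn.
by rewrite /t [X in _ == X]mulrC divfK ?eqxx // pnatr_eq0 addn1.
Qed.

Lemma multiple_angle_lt_pi n j : (0 < j <= n)%N ->
  0 < j%:R * (2 * pi / (2 * n + 1)%:R : R) < pi.
Proof.
move=> /andP[j0 jn].
have D0 : 0 < (2 * n + 1)%:R :> R by rewrite ltr0n addn1.
have p0 := pi_gt0 R.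
rewrite !mulr_gt0 ?ltr0n ?invr_gt0 //= mulrA ltr_pdivrMr //.
have : j%:R <= n%:R :> R by rewrite ler_nat.
rewrite natrD natrM => jn'.
by nra.
Qed.

Lemma two_plus_two_cos_angle_gt0 n : (0 < n)%N ->
  0 < 2 + 2 * cos (2 * pi / (2 * n + 1)%:R : R).
Proof.
move=> n0; have := @multiple_angle_lt_pi n 1; rewrite n0 mul1r => /(_ isT).
set t : R := 2 * pi / _ => /andP[t0 tpi].
(* 2 + 2 cos t = 4 (cos (t / 2))^2 *)
have -> : t = t / 2 + t / 2 by field.
rewrite cosD -!expr2 sin2cos2.
have c0 : 0 < cos (t / 2) by rewrite cos_gt0_pihalf //; apply/andP; split; lra.
by rewrite !expr2; nra.
Qed.

End TailSums.

(** The form of X at q is a times the sum of the squared tail sums of q, and the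
    entries of q are the increments of these tail sums. *)
Lemma uniform_reactance_coercive (R : realType) (n : nat) (x : 'I_n -> R)
    (a : R) (q : 'cV[R]_n) :
  (0 < n)%N -> (forall k, 0 < x k) -> (forall k, x k = a) ->
  a / (2 + 2 * cos (2 * pi / (2 * n + 1)%:R)) * dot q q <=
  dot q (reactance_mx x *m q).
Proof.
move=> n0 x0 xa; have a0 : 0 < a by rewrite -(xa (Ordinal n0)).
set t : R := 2 * pi / _.
have C0 : 0 < 2 + 2 * cos t by exact: two_plus_two_cos_angle_gt0.
(* Tail sums counted from the far end of the path, so that s 0 = 0. *)
pose s (j : nat) : R := \sum_(i < n | (n - j <= i)%N) q i 0.
have rn : sin (n.+1%:R * t) = - sin (n%:R * t).
  by rewrite succ_angleE -/t sinB mulr_natl sin2pi cos2pi; ring.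
have s0 : s 0%N = 0.
  by rewrite /s big1 // => i; rewrite subn0 leqNgt ltn_ord.
have r0 : sin (0%:R * t) = 0 by rewrite mul0r sin0.
have rpos j : (0 < j <= n)%N -> 0 < sin (j%:R * t).
  by move=> /multiple_angle_lt_pi /sin_gt0_pi.
have := sum_sqr_increments_le (cos t) (fun j => sin (j%:R * t)) s n
  r0 (sin_add2 t) rpos rn s0.
have -> : \sum_(j < n) (s j.+1 - s j) ^+ 2 = dot q q.
  rewrite dotE (reindex_inj rev_ord_inj); apply: eq_bigr => i _ /=.
  rewrite -expr2; congr (_ ^+ 2).
  have E : (n - (n - i.+1).+1 = i)%N by rewrite subnSK // subKn // ltnW.
  have E' : (n - (n - i.+1) = i.+1)%N by rewrite subKn.
  rewrite /s E E' (bigD1 i) //= (eq_bigl (fun l : 'I_n => (i < l)%N)) ?addrK //.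
  by move=> l; rewrite ltn_neqAle andbC eq_sym.
have -> : \sum_(j < n) s j.+1 ^+ 2 =
    \sum_(k < n) (\sum_(i < n | (k <= i)%N) q i 0) ^+ 2.
  rewrite (reindex_inj rev_ord_inj); apply: eq_bigr => i _ /=.
  have E : (n - (n - i.+1).+1 = i)%N by rewrite subnSK // subKn // ltnW.
  by rewrite /s E.
move=> H; rewrite -dot_quad reactance_quadE.
under [X in _ <= X]eq_bigr => k _ do rewrite xa.
by rewrite -mulr_sumr -mulrA ler_pM2l // mulrC ler_pdivrMr // mulrC.
Qed.

(** * The price of anarchy *)

(** The assembly for arbitrary reactances: the line reactances and the y i enter
    the bound only through a coercivity constant [m] of X + Y and a bound [L] of
    the diagonal of X. *)
Lemma PoSA_le_coercive (R : realType) (n : nat) (x y : 'I_n -> R) (m L : R)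
    (v : 'cV[R]_n) (X := reactance_mx x) (Y := fun_diag_mx y) :
    (forall k, 0 < x k) -> (forall i, 0 < y i) -> 0 < m -> 0 <= L ->
    (forall q, m * dot q q <= dot q ((X + Y) *m q)) -> (forall i, X i i <= L) ->
  PoSA X Y v <= L ^+ 2 / ((L + m) ^+ 2 * m) * dot v v.
Proof.
move=> x_gt0 y_gt0 m0 L0 coer XL.
have pS := posdef_social x_gt0 y_gt0; have pP := posdef_potential x_gt0 y_gt0.
rewrite -/X -/Y in pS pP.
have X_ge0 i : 0 <= X i i by rewrite mxE sumr_ge0 // => k _; exact: ltW.
have dL i : 0 <= (\row_i X i i) 0 i <= L by rewrite mxE X_ge0 XL.
set qa := dec_ctrl X Y v; set qo := opt_ctrl X Y v; pose D := diag_part X.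
have Ea : (X + Y + D) *m qa = - v.
  rewrite /qa dec_ctrlE // -/X -/Y -/D addrAC mulNmx mulmxN mulKVmx //.
  exact: posdef_unitmx.
have Eo : (X + Y) *m qo = - v.
  rewrite /qo opt_ctrlE // -/X -/Y mulNmx mulmxN mulKVmx //.
  exact: posdef_unitmx.
have DN w : 0 <= dot (D *m w) ((X + Y) *m w).
  rewrite mulmxDl dotDr addr_ge0 ?diag_part_reactance_ge0 //.
  rewrite diag_dotE sumr_ge0 // => i _; rewrite mxE mulr_ge0 ?(ltW (y_gt0 i)) //.
  by rewrite mul_diag_mx mxE [(\row_i0 _) _ _]mxE -mulrA -expr2 mulr_ge0 ?sqr_ge0.
have Nd : (X + Y) *m (qa - qo) = - (D *m qa).
  by rewrite mulmxBr Eo -Ea [in X in _ - X]mulmxDl opprD addrA subrr add0r.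
have -> : PoSA X Y v = 2^-1 * dot (qa - qo) ((X + Y) *m (qa - qo)).
  have Eqo : qo = - invmx (X + Y) *m v by exact: opt_ctrlE.
  by rewrite /PoSA -/qa -/qo /social_cost Eqo quad_costB // dot_quad.
have := coercive_quad_le_sqnorm (X + Y) m (qa - qo) m0 coer.
rewrite {2 3}Nd dotNN.
have := perturbed_sqnorm_ge (X + Y) (\row_i X i i) m L qa m0 coer dL (DN qa).
rewrite -/(diag_part X) -/D Ea dotNN.
move: (dot v v) (dot (D *m qa) _) (dot (qa - qo) _) => z s g h1 h2.
have Lm0 : 0 < L + m by rewrite ltr_wpDl.
rewrite mulrAC ler_pdivlMr ?mulr_gt0 ?exprn_gt0 //.
have := ler_wpM2l (sqr_ge0 (L + m)) h2.
lra.
Qed.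

Theorem theorem8 (R : realType) (n : nat) (n_gt0 : (0 < n)%N)
    (x : 'I_n -> R) (a : R) (y : 'I_n -> R)
    (x_gt0 : forall k, 0 < x k) (x_eq : forall k, x k = a)
    (y_gt0 : forall i, 0 < y i) :
  let c := a / (2 + 2 * cos (2 * pi / (2 * n + 1)%:R)) in
  let ymin := min_entry n_gt0 y in
  (PoSA_max (reactance_mx x) (fun_diag_mx y) <=
   ((a * n%:R) ^+ 2 / ((c + a * n%:R + ymin) ^+ 2 * (ymin + c)))%:E)%E.
Proof.
cbv zeta; set c := a / (2 + _); set ymin := min_entry _ _.
have a0 : 0 < a by rewrite -(x_eq (Ordinal n_gt0)).
have c0 : 0 < c by rewrite divr_gt0 // two_plus_two_cos_angle_gt0.
have [[i0 ymin_i0] ymin_le] := min_entryP n_gt0 y.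
rewrite -/ymin in ymin_i0 ymin_le.
have ym0 : 0 < ymin by rewrite ymin_i0.
apply: ge_ereal_sup => _ [v /= v0 <-]; rewrite lee_fin.
rewrite -/(dot v v) ler_pdivrMr ?dot_gt0 //.
have -> : c + a * n%:R + ymin = a * n%:R + (ymin + c) by ring.
apply: PoSA_le_coercive => //.
- by rewrite addr_gt0.
- by rewrite mulr_ge0 ?ler0n ?ltW.
- move=> q; rewrite mulmxDl dotDr mulrDl addrC.
  rewrite lerD ?uniform_reactance_coercive //.
  rewrite diag_dotE dotE mulr_sumr; apply: ler_sum => i _.
  by rewrite mxE ler_wpM2r // -expr2 sqr_ge0.
- move=> i; rewrite mxE.
  under eq_bigr => k _ do rewrite x_eq.
  rewrite sumr_const -(mulr_natr a) ler_pM2l // ler_nat.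
  by rewrite -[X in (_ <= X)%N]card_ord max_card.
Qed.
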